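(* Assume (A1) (stated in the context). Let $m,n\in\mathbb Z$ with $m\le n$ and $\theta\in\Theta$. Then for all $k\ge m$, all probability measures $\mu_1$ and $\mu_2$ on $\mathcal B(\mathcal X)$ and all $\overline{\mathbf Y}_m^n$, $$\left\|\int_{\mathcal X}\overline{\mathbb P}_\theta(X_k\in\cdot\mid X_m=x,\overline{\mathbf Y}_m^n)\,\mu_1(dx)-\int_{\mathcal X}\overline{\mathbb P}_\theta(X_k\in\cdot\mid X_m=x,\overline{\mathbf Y}_m^n)\,\mu_2(dx)\right\|_{\mathrm{TV}}\le\rho^{k-m},$$ where $\rho:=1-\sigma_-/\sigma_+$.
   Context: Setting. $\mathcal X$ is a separable compact set with a metrizable topology and Borel $\sigma$-field $\mathcal B(\mathcal X)$; $\mu$ is a probability measure on $\mathcal X$. $\mathcal Y$ is a set that is separable and metrizable by a complete metric, with its Borel $\sigma$-field; $\nu$ is a $\sigma$-finite measure on it. $s\ge 1$ is an integer. $\Theta$ is a compact subset of a Euclidean space. For each $\theta\in\Theta$, $\{X_k\}$ is a homogeneous Markov chain on $\mathcal X$ with transition kernel $Q_\theta(x,dx')=q_\theta(x,x')\mu(dx')$; writing $\overline{\mathbf Y}_k=(Y_k,Y_{k-1},\dots,Y_{k-s+1})$, $Y_n$ is, given $\overline{\mathbf Y}_{n-1}$ and $X_n$, conditionally independent of the remaining past and has conditional density $g_\theta(\cdot\mid\overline{\mathbf Y}_{n-1},X_n)$ with respect to $\nu$. Thus $Z_k=(X_k,\overline{\mathbf Y}_k)$ is a Markov chain on $\mathcal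 X\times\mathcal Y^s$; it is assumed throughout that its transition kernel has a unique invariant distribution $\pi_\theta$; $\overline{\mathbb P}_\theta$ denotes the law of the stationary chain, extended to time index $\mathbb Z$. Notation: $\overline{\mathbf Y}_m^n=(\overline{\mathbf Y}_m,\dots,\overline{\mathbf Y}_n)$; $\|\mu_1-\mu_2\|_{\mathrm{TV}}=\sup_A|\mu_1(A)-\mu_2(A)|$. For functions on $\mathcal X$, $\sup$ and $\inf$ over $x$ mean essential supremum and infimum with respect to $\mu$. Version of the conditional law (conditional probabilities are always taken in the version expressed through the transition kernel): given $X_m=x$ and $\overline{\mathbf Y}_m^n$, $(X_{m+1},\dots,X_n)$ has density with respect to $\mu^{\otimes(n-m)}$ proportional to $\prod_{i=m+1}^n q_\theta(x_{i-1},x_i)g_\theta(Y_i\mid\overline{\mathbf Y}_{i-1},x_i)$ with $x_m=x$, and $X_k$ for $k>n$ evolves from $X_n$ according to $Q_\theta$; for $k=m$ the law is the Dirac mass at $x$. (A1) (a) $0<\sigma_-:=\inf_{\theta}\inf_{x,x'}q_\theta(x,x')$ and $\sigma_+:=\sup_{\theta}\sup_{x,x'}q_\theta(x,x')<\infty$. (b) For all $y'\in\mathcal Y$, $\bar{\mathbf y}\in\mathcal Y^s$: $0<\inf_\theta\int g_\theta(y'\mid\bar{\mathbf y},x)\mu(dx)$ and $\sup_\theta\int g_\theta(y'\mid\bar{\mathbf y},x)\mu(dx)<\infty$.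
   Formalization: In (A1)(a) the bounds on q_θ(x,x') are taken over every starting state x and are essential only in x'; with bounds essential in x too, the claim fails for μ₁, μ₂ charging μ-null sets (e.g. Dirac masses). *)

(* Defs.v *)
From HB Require Import structures.
From mathcomp Require Import all_boot all_order all_algebra.
From mathcomp Require Import all_classical all_reals all_analysis ess_sup_inf.

Set Implicit Arguments.
Unset Strict Implicit.
Unset Printing Implicit Defensive.

Import Order.TTheory GRing.Theory Num.Theory.
Import numFieldNormedType.Exports.

Local Open Scope classical_set_scope.
Local Open Scope ring_scope.
Local Open Scope ereal_scope.

Notation borel T := (g_sigma_algebraType (@open T)).

Definition separable (T : topologicalType) :=
  exists2 D : set T, countable D & dense D.

(* A topology is metrizable iff it is induced by some Hausdorff pseudometric
   structure; such a structure is fixed on X and on Y, the one on Y being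
   complete.  Nothing below depends on it beyond the topology.  The base points
   are harmless: X carries a probability measure and Y a probability density. *)
Definition compact_metrizable (R : realType) (X : pseudoPMetricType R) :=
  [/\ separable X, hausdorff_space X & compact [set: X]].

Definition separable_complete_metrizable (R : realType)
    (Y : completePseudoMetricType R) :=
  separable Y /\ hausdorff_space Y.

(* ||mu1 - mu2||_TV = sup_A |mu1 A - mu2 A| *)
Definition tv_dist d (T : measurableType d) (R : realType)
    (m1 m2 : set T -> \bar R) : \bar R :=
  ereal_sup [set `|m1 A - m2 A| | A in measurable].

Section power_measure.
Context d (T : measurableType d) (R : realType) (mu : probability T R).

Definition tuple_cons N (z : T * N.-tuple T) : N.+1.-tuple T :=
  [tuple of z.1 :: z.2].

Lemma measurable_tuple_cons N :
  measurable_fun [set: T * N.-tuple T] (@tuple_cons N).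
Proof. exact: (measurable_cons measurable_fst measurable_snd). Qed.

HB.instance Definition _ N :=
  isMeasurableFun.Build _ _ _ _ (@tuple_cons N) (@measurable_tuple_cons N).

Definition power_cons N (P : probability (N.-tuple T) R) :
    probability (N.+1.-tuple T) R :=
  distribution (mu \x P) (@tuple_cons N).

(* The product measure mu^{\otimes N}. *)
Fixpoint power_measure N : probability (N.-tuple T) R :=
  match N with
  | 0%N => dirac [tuple]
  | N'.+1 => power_cons (power_measure N')
  end.

End power_measure.

Section fixed_parameter.
Context (R : realType) (X : pseudoPMetricType R)
  (Y : completePseudoMetricType R) (s : nat).
Variables (mu : probability (borel X) R)
  (nu : {sigma_finite_measure set (borel Y) -> \bar R}).
(* q x x' is q(x, x'); g y' ybar x is g(y' | ybar, x). *)
Variables (q : borel X -> borel X -> R)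
  (g : borel Y -> s.-tuple (borel Y) -> borel X -> R).

Record transition_densities : Prop := {
  q_measurable :
    measurable_fun [set: borel X * borel X] (fun z => q z.1 z.2) ;
  q_ge0 : forall x x', (0 <= q x x')%R ;
  q_integral : forall x, \int[mu]_x' (q x x')%:E = 1 ;
  g_measurable :
    measurable_fun [set: borel Y * (s.-tuple (borel Y) * borel X)]
      (fun z => g z.1 z.2.1 z.2.2) ;
  g_ge0 : forall y' ybar x, (0 <= g y' ybar x)%R ;
  g_integral : forall ybar x, \int[nu]_y' (g y' ybar x)%:E = 1
}.

(* (y_k, ..., y_{k-s+1}) |-> (y', y_k, ..., y_{k-s+2}) *)
Definition lag_shift (y' : borel Y) (ybar : s.-tuple (borel Y)) :
    s.-tuple (borel Y) :=
  [tuple nth y' (y' :: ybar) i | i < s].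

(* Transition kernel of Z_k = (X_k, Ybar_k). *)
Definition Z_kernel (z : borel X * s.-tuple (borel Y))
    (A : set (borel X * s.-tuple (borel Y))) : \bar R :=
  \int[mu]_x' ((q z.1 x')%:E *
    \int[nu]_y' ((g y' z.2 x')%:E * (\1_A (x', lag_shift y' z.2))%:E)).

Definition invariant_distribution
    (p : probability (borel X * s.-tuple (borel Y))%type R) :=
  forall A, measurable A -> p A = \int[p]_z Z_kernel z A.

Definition unique_invariant_distribution :=
  exists p : probability (borel X * s.-tuple (borel Y))%type R,
    invariant_distribution p /\
    forall p' : probability (borel X * s.-tuple (borel Y))%type R,
      invariant_distribution p' -> forall A, measurable A -> p' A = p A.

(* j-step transition kernel of the chain X, with Q(x, dx') = q(x, x') mu(dx'). *)
Fixpoint Q_iter (j : nat) (x : borel X) (A : set (borel X)) : \bar R :=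
  match j with
  | 0%N => \d_x A
  | j'.+1 => \int[mu]_x' ((q x x')%:E * Q_iter j' x' A)
  end.

(* A trajectory of Y is indexed by all integers, but only y_{m-s+1}, ..., y_n
   enter the conditional law given Ybar_m, ..., Ybar_n. *)
Definition lags (y : int -> borel Y) (k : int) : s.-tuple (borel Y) :=
  [tuple y (k - (val i)%:Z)%R | i < s].

(* For t = (x_{m+1}, ..., x_{m+N}) and x_m = x, the state x_{m+i}. *)
Definition path_state N (x : borel X) (t : N.-tuple (borel X)) (i : nat) :
    borel X :=
  nth x (x :: t) i.

(* \prod_{i=m+1}^{m+N} q(x_{i-1}, x_i) g(y_i | ybar_{i-1}, x_i); the factor of
   index i below is that of time m + i + 1. *)
Definition path_weight (y : int -> borel Y) (m : int) N (x : borel X)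
    (t : N.-tuple (borel X)) : R :=
  (\prod_(i < N) (q (path_state x t i) (path_state x t i.+1) *
     g (y (m + i.+1%:Z)) (lags y (m + (val i)%:Z)) (path_state x t i.+1)))%R.

(* Expectation of F(X_{m+1}, ..., X_{m+N}) for the law of density proportional
   to path_weight with respect to mu^{\otimes N}. *)
Definition path_expectation (y : int -> borel Y) (m : int) N (x : borel X)
    (F : N.-tuple (borel X) -> \bar R) : \bar R :=
  (\int[power_measure mu N]_t ((path_weight y m x t)%:E * F t)) *
  ((fine (\int[power_measure mu N]_t (path_weight y m x t)%:E))^-1)%:E.

(* P(X_k \in A | X_m = x, Ybar_m^n), meant for m <= n and m <= k. *)
Definition cond_law (y : int -> borel Y) (m n k : int) (x : borel X)
    (A : set (borel X)) : \bar R :=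
  if k == m then \d_x A
  else if (k <= n)%R then
    path_expectation (N := `|n - m|%N) y m x
      (fun t => (\1_A (path_state x t `|k - m|%N))%:E)
  else
    path_expectation (N := `|n - m|%N) y m x
      (fun t => Q_iter `|k - n|%N (path_state x t `|n - m|%N) A).

End fixed_parameter.

Section assumption_A1.
Context (R : realType) (X : pseudoPMetricType R)
  (Y : completePseudoMetricType R) (s : nat) (T : Type).
Variables (mu : probability (borel X) R) (Theta : set T)
  (q : T -> borel X -> borel X -> R)
  (g : T -> borel Y -> s.-tuple (borel Y) -> borel X -> R).

(* q theta x is a density with respect to mu, so the bounds on it are essential
   in x'.  They are required from every starting point x, not merely from
   mu-almost every one: the initial laws mu1, mu2 may charge mu-null sets, on
   which bounds essential in x would say nothing. *)
Definition sigma_minus : \bar R :=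
  ereal_inf [set ess_inf mu (EFin \o q theta x) |
             theta in Theta & x in [set: borel X]].

Definition sigma_plus : \bar R :=
  ereal_sup [set ess_sup mu (EFin \o q theta x) |
             theta in Theta & x in [set: borel X]].

Definition rho : R := (1 - fine sigma_minus / fine sigma_plus)%R.

Record A1 : Prop := {
  A1a_minus : 0 < sigma_minus ;
  A1a_plus : sigma_plus < +oo ;
  A1b_inf : forall y' ybar,
    0 < ereal_inf [set \int[mu]_x (g theta y' ybar x)%:E | theta in Theta] ;
  A1b_sup : forall y' ybar,
    ereal_sup [set \int[mu]_x (g theta y' ybar x)%:E | theta in Theta] < +oo
}.

End assumption_A1.

(* Main.v *)
Require Import Defs.
From HB Require Import structures.
From mathcomp Require Import all_boot all_order all_algebra.
From mathcomp Require Import all_classical all_reals all_analysis.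
From mathcomp Require Import measurable_realfun ess_sup_inf.
From mathcomp Require Import ring lra zify.

Set Implicit Arguments.
Unset Strict Implicit.
Unset Printing Implicit Defensive.

Import Order.TTheory GRing.Theory Num.Theory.
Import numFieldNormedType.Exports.

Local Open Scope classical_set_scope.
Local Open Scope ring_scope.
Local Open Scope ereal_scope.

(** The conditional law of [X_k] given [X_m = x] and the observations is a
quotient of backward integrals.  For a weight [g] on the state space let
  [transfer g u x = \int q(x, x') g(x') u(x') mu(dx')].
Integrating out the path one state at a time, the last one innermost, turns the
unnormalised expectation of [h (X_{m+j})] into a composition of such
operators: [transfers _ j (h * v)], where [v] is the likelihood of the
observations after time [m + j] as a function of the state at that time
([integral_weight_path]).  The normalising constant is the same expression with
[h = 1], and the chain after time [n] follows the operator with [g = 1]; this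
gives a single formula for all [k] ([cond_lawE]).

The bound is a statement on the oscillation of ratios.  Assume
[a w <= W <= (a + r) w] pointwise, and let [c = \int W / \int w].  The functions
[W - a w] and [(a + r) w - W] are nonnegative, so replacing [q(x, x')] by its
lower bound [lo] gives
  [\int q W - a \int q w >= lo (c - a) \int w >= (lo / hi) (c - a) \int q w],
and similarly on the other side.  Hence the ratio [\int q W / \int q w], as a
function of [x], stays in an interval of length [(1 - lo / hi) r] which does not
depend on [x] ([doeblin_contraction]).  Each transition from [m] to [k], whether
it is weighted by an observation or not, is one such step; taken backward from
[k], they start from an indicator function, of oscillation at most 1.  Thus
[x |-> P(X_k \in A | X_m = x, ...)] takes its values in an interval of length
[rho ^ (k - m)] ([cond_law_oscillation]); so do its averages under [mu1] and
[mu2], for every event [A], which is the bound in total variation. *)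

(** * Contraction of ratios under a transfer operator *)

Section transfer_operator.
Context d (T : measurableType d) (R : realType) (mu : probability T R).
Variables (q : T -> T -> R) (lo hi : R).

(** Initial laws may charge [mu]-null sets, on which bounds essential in the
starting state would say nothing; the target state only occurs under an integral
against [mu]. *)
Record doeblin_density : Prop := {
  density_measurable : measurable_fun [set: T * T] (fun z => q z.1 z.2) ;
  density_ge0 : forall x x', (0 <= q x x')%R ;
  lower_gt0 : (0 < lo)%R ;
  lower_le_upper : (lo <= hi)%R ;
  density_ge_lower : forall x, \forall x' \ae mu, (lo <= q x x')%R ;
  density_le_upper : forall x, \forall x' \ae mu, (q x x' <= hi)%R
}.

(** A weight on the states, called a potential as in Feynman-Kac formulas; the
positive integral keeps normalising constants away from 0. *)
Record potential (g : T -> R) : Prop := {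
  potential_measurable : measurable_fun [set: T] g ;
  potential_ge0 : forall x, (0 <= g x)%R ;
  potential_gt0 : 0 < \int[mu]_x (g x)%:E ;
  potential_lty : \int[mu]_x (g x)%:E < +oo
}.

Definition measurable_between (b B : R) (u : T -> R) :=
  measurable_fun [set: T] u /\ forall x, (b <= u x <= B)%R.

(** One backward step: the unnormalised conditional expectation of [u], given
the state [x] one unit of time earlier, when the arrival state is weighted by
the likelihood [g]. *)
Definition transfer (g u : T -> R) (x : T) : R :=
  (\int[mu]_x' (q x x' * (g x' * u x')))%R.

Fixpoint transfers (g : nat -> T -> R) (N : nat) (u : T -> R) : T -> R :=
  if N is N'.+1 then transfer (g 0%N) (transfers (g \o succn) N' u) else u.

Hypothesis qD : doeblin_density.

Lemma measurable_density x : measurable_fun [set: T] (q x).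
Proof.
exact: (measurableT_comp (density_measurable qD) (pair1_measurable x)).
Qed.

Lemma density_integralP (v : T -> R) x : (forall x', (0 <= v x')%R) ->
  mu.-integrable [set: T] (EFin \o v) ->
  [/\ mu.-integrable [set: T] (EFin \o (fun x' => q x x' * v x')%R),
      (lo * \int[mu]_x' v x' <= \int[mu]_x' (q x x' * v x'))%R &
      (\int[mu]_x' (q x x' * v x') <= hi * \int[mu]_x' v x')%R].
Proof.
move=> v0 iv.
have /measurable_EFinP mv := measurable_int _ iv.
have mqv : measurable_fun [set: T] (fun x' => q x x' * v x')%R.
  by apply: measurable_funM => //; exact: measurable_density.
have lo0 := ltW (lower_gt0 qD).
have hi0 : (0 <= hi)%R := le_trans lo0 (lower_le_upper qD).
have qv0 x' : (0 <= q x x' * v x')%R by rewrite mulr_ge0 ?(density_ge0 qD).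
have Zl c : (0 <= c)%R ->
    \int[mu]_x' (c * v x')%:E = c%:E * \int[mu]_x' (v x')%:E.
  move=> c0; under eq_integral do rewrite EFinM.
  by rewrite ge0_integralZl//; [exact/measurable_EFinP|move=> ? _; rewrite lee_fin].
have le_hi : \int[mu]_x' (q x x' * v x')%:E <= hi%:E * \int[mu]_x' (v x')%:E.
  rewrite -Zl//; apply: ae_ge0_le_integral => //.
  - by move=> ? _; rewrite lee_fin.
  - exact/measurable_EFinP.
  - by move=> ? _; rewrite lee_fin mulr_ge0.
  - by apply/measurable_EFinP/measurable_funM.
  - apply: filterS (density_le_upper qD x) => x' qhi _.
    by rewrite lee_fin ler_wpM2r.
have ge_lo : lo%:E * \int[mu]_x' (v x')%:E <= \int[mu]_x' (q x x' * v x')%:E.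
  rewrite -Zl//; apply: ae_ge0_le_integral => //.
  - by move=> ? _; rewrite lee_fin mulr_ge0.
  - by apply/measurable_EFinP/measurable_funM.
  - by move=> ? _; rewrite lee_fin.
  - exact/measurable_EFinP.
  - apply: filterS (density_ge_lower qD x) => x' qlo _.
    by rewrite lee_fin ler_wpM2r.
have fv : \int[mu]_x' (v x')%:E \is a fin_num := integrable_fin_num measurableT iv.
have iqv : mu.-integrable [set: T] (EFin \o (fun x' => q x x' * v x')%R).
  apply/integrableP; split; first exact/measurable_EFinP.
  under eq_integral do rewrite gee0_abs ?lee_fin//.
  by apply: le_lt_trans le_hi _; rewrite -(fineK fv) -EFinM ltry.
have fqv : \int[mu]_x' (q x x' * v x')%:E \is a fin_num.
  exact: integrable_fin_num iqv.
split => //; rewrite /Rintegral.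
  by rewrite -lee_fin EFinM !fineK.
by rewrite -lee_fin EFinM !fineK.
Qed.

(** Comparing [W] with both [a * w] and [(a + r) * w] through nonnegative
differences lets [q] be minorised by [lo]; the mass gained in this way is
proportional to [lo * \int w], which dominates [lo / hi] times [\int q w].  The
new lower end is the barycentre of [a] and the global ratio [\int W / \int w],
with weights [1 - lo / hi] and [lo / hi]. *)
Lemma doeblin_contraction (w W : T -> R) (a r : R) :
  mu.-integrable [set: T] (EFin \o w) -> mu.-integrable [set: T] (EFin \o W) ->
  (0 <= a)%R -> (0 <= r)%R -> (forall x, (0 <= w x)%R) ->
  (forall x, (a * w x <= W x <= (a + r) * w x)%R) ->
  exists2 a', (0 <= a')%R & forall x,
    (a' * \int[mu]_x' (q x x' * w x') <= \int[mu]_x' (q x x' * W x')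
     <= (a' + (1 - lo / hi) * r) * \int[mu]_x' (q x x' * w x'))%R.
Proof.
move=> iw iW a0 r0 w0 wW.
have lo0 := lower_gt0 qD; have lohi := lower_le_upper qD.
have hi0 : (0 < hi)%R := lt_le_trans lo0 lohi.
have iZ c (v : T -> R) : mu.-integrable [set: T] (EFin \o v) ->
    mu.-integrable [set: T] (EFin \o (fun x => c * v x)%R).
  by move=> iv; have := integrableZl measurableT c iv; apply: eq_integrable.
have W0 x : (0 <= W x)%R.
  by have /andP[+ _] := wW x; apply: le_trans; rewrite mulr_ge0.
set I := (\int[mu]_x w x)%R; set J := (\int[mu]_x W x)%R.
have I0 : (0 <= I)%R by apply: Rintegral_ge0.
have aIJ : (a * I <= J <= (a + r) * I)%R.
  rewrite -!RintegralZl//; apply/andP; split; apply: le_Rintegral => //.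
  - exact: iZ.
  - by move=> x _; have /andP[] := wW x.
  - exact: iZ.
  - by move=> x _; have /andP[] := wW x.
(* If I = 0 then J = 0 as well, and any constant in [a, a + r] will do. *)
have [c /andP[ac car] cI] : exists2 c, (a <= c <= a + r)%R & (c * I = J)%R.
  have [I00|In0] := eqVneq I 0%R.
    exists a; first by rewrite lexx lerDl.
    by move: aIJ; rewrite I00 !mulr0 => ?; apply/eqP; rewrite eq_le.
  have Igt0 : (0 < I)%R by rewrite lt_neqAle eq_sym In0.
  exists (J / I)%R; last by rewrite divfK.
  by rewrite ler_pdivlMr// ler_pdivrMr.
have c0 : (0 <= c)%R := le_trans a0 ac.
set e := (lo / hi)%R.
have e0 : (0 < e)%R by rewrite divr_gt0.
have e1 : (e <= 1)%R by rewrite ler_pdivrMr ?mul1r.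
have ehi : (e * hi = lo)%R by rewrite divfK// gt_eqF.
exists (e * c + (1 - e) * a)%R.
  by rewrite addr_ge0// mulr_ge0// ?subr_ge0// ltW.
move=> x.
have [iqw _ qw_hi] := density_integralP x w0 iw.
have [iqW _ _] := density_integralP x W0 iW.
set Iq := (\int[mu]_x' (q x x' * w x'))%R in qw_hi *.
set Jq := (\int[mu]_x' (q x x' * W x'))%R.
rewrite -/I in qw_hi.
have low : (lo * (J - a * I) <= Jq - a * Iq)%R.
  have iv : mu.-integrable [set: T] (EFin \o (fun x => W x - a * w x)%R).
    have := integrableB measurableT iW (iZ a _ iw).
    by apply: eq_integrable.
  have v0 x' : (0 <= W x' - a * w x')%R by rewrite subr_ge0; have /andP[] := wW x'.
  have [_ + _] := density_integralP x v0 iv.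
  rewrite RintegralB// ?RintegralZl//; last exact: iZ.
  move=> /le_trans; apply; rewrite -RintegralZl// -RintegralB//; last exact: iZ.
  rewrite le_eqVlt; apply/orP; left; apply/eqP; apply: eq_Rintegral => x' _; ring.
have upp : (lo * ((a + r) * I - J) <= (a + r) * Iq - Jq)%R.
  have iv : mu.-integrable [set: T] (EFin \o (fun x => (a + r) * w x - W x)%R).
    have := integrableB measurableT (iZ (a + r)%R _ iw) iW.
    by apply: eq_integrable.
  have v0 x' : (0 <= (a + r) * w x' - W x')%R.
    by rewrite subr_ge0; have /andP[] := wW x'.
  have [_ + _] := density_integralP x v0 iv.
  rewrite RintegralB// ?RintegralZl//; last exact: iZ.
  move=> /le_trans; apply; rewrite -RintegralZl// -RintegralB//; last exact: iZ.
  rewrite le_eqVlt; apply/orP; left; apply/eqP; apply: eq_Rintegral => x' _; ring.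
have eIq : (e * Iq <= lo * I)%R by rewrite -ehi -mulrA ler_wpM2l// ltW.
have lowc : ((c - a) * (e * Iq) <= lo * (J - a * I))%R.
  rewrite -cI -mulrBl [leRHS]mulrCA; by apply: ler_wpM2l => //; rewrite subr_ge0.
have uppc : ((a + r - c) * (e * Iq) <= lo * ((a + r) * I - J))%R.
  rewrite -cI -mulrBl [leRHS]mulrCA; by apply: ler_wpM2l => //; rewrite subr_ge0.
by apply/andP; split; lra.
Qed.

Lemma potential_integrable g : potential g ->
  mu.-integrable [set: T] (EFin \o g).
Proof.
move=> [mg g0 _ goo]; apply/integrableP; split; first exact/measurable_EFinP.
by under eq_integral do rewrite gee0_abs ?lee_fin//.
Qed.

Lemma potential_Rintegral_gt0 g : potential g -> (0 < \int[mu]_x g x)%R.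
Proof.
move=> pg; rewrite -lte_fin /Rintegral fineK ?(potential_gt0 pg)//.
exact: integrable_fin_num (potential_integrable pg).
Qed.

Lemma potential_mul_integralP g b B u : potential g -> measurable_between b B u ->
  (0 <= b)%R ->
  [/\ mu.-integrable [set: T] (EFin \o (fun x => g x * u x)%R),
      (b * \int[mu]_x g x <= \int[mu]_x (g x * u x))%R &
      (\int[mu]_x (g x * u x) <= B * \int[mu]_x g x)%R].
Proof.
move=> pg [mu_ ubB] b0; have [mg g0 _ _] := pg.
have ig := potential_integrable pg.
have iZ c : mu.-integrable [set: T] (EFin \o (fun x => c * g x)%R).
  by have := integrableZl measurableT c ig; apply: eq_integrable.
have gu x : (b * g x <= g x * u x <= B * g x)%R.
  by have /andP[? ?] := ubB x; rewrite ![(_ * g x)%R]mulrC !ler_wpM2l.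
have igu : mu.-integrable [set: T] (EFin \o (fun x => g x * u x)%R).
  apply: le_integrable (iZ B) => //.
    by apply/measurable_EFinP/measurable_funM.
  move=> x _ /=; have /andP[bgu guB] := gu x.
  have gu0 : (0 <= g x * u x)%R by rewrite (le_trans _ bgu)// mulr_ge0.
  by rewrite lee_fin !ger0_norm// (le_trans gu0).
split => //; rewrite -RintegralZl//; apply: le_Rintegral => // x _.
  by have /andP[] := gu x.
by have /andP[] := gu x.
Qed.

Lemma between_transfer g b B u :
  potential g -> measurable_between b B u -> (0 <= b)%R ->
  measurable_between (lo * (b * \int[mu]_x g x))%R (hi * (B * \int[mu]_x g x))%R
    (transfer g u).
Proof.
move=> pg uP b0; have [mg g0 _ _] := pg; have [mu_ ubB] := uP.
have [igu bI IB] := potential_mul_integralP pg uP b0.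
have u0 x : (0 <= u x)%R by have /andP[+ _] := ubB x; apply: le_trans.
have gu0 x : (0 <= g x * u x)%R by rewrite mulr_ge0.
have lo0 := ltW (lower_gt0 qD).
have hi0 : (0 <= hi)%R := le_trans lo0 (lower_le_upper qD).
split; last first.
  move=> x; have [_ lI Ih] := density_integralP x gu0 igu.
  by rewrite (le_trans _ lI) ?ler_wpM2l// (le_trans Ih)// ler_wpM2l.
apply: measurableT_comp => //.
apply: (@measurable_fun_fubini_tonelli_F _ _ _ _ _ mu
  (fun z => (q z.1 z.2 * (g z.2 * u z.2))%:E)).
  apply/measurable_EFinP/measurable_funM; first exact: density_measurable qD.
  by apply: measurable_funM; apply: measurableT_comp.
by move=> z; rewrite lee_fin mulr_ge0// (density_ge0 qD).
Qed.

Lemma transferE g b B u x :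
  potential g -> measurable_between b B u -> (0 <= b)%R ->
  (transfer g u x)%:E = \int[mu]_x' (q x x' * (g x' * u x'))%:E.
Proof.
move=> pg uP b0; have [igu _ _] := potential_mul_integralP pg uP b0.
have gu0 x' : (0 <= g x' * u x')%R.
  by rewrite mulr_ge0 ?(potential_ge0 pg)// (le_trans b0)//; have /andP[] := uP.2 x'.
have [iq _ _] := density_integralP x gu0 igu.
by rewrite /transfer /Rintegral fineK// (integrable_fin_num _ iq).
Qed.

(** Nonnegativity of the lower bound is what makes the integrals above
meaningful; its strict positivity passes from the constant 1 to the normalising
constant of the conditional law. *)
Lemma between_transfers g N b B u : (forall i, potential (g i)) ->
  measurable_between b B u -> (0 <= b)%R ->
  exists b' B', [/\ measurable_between b' B' (transfers g N u), (0 <= b')%R &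
                    (0 < b)%R -> (0 < b')%R].
Proof.
move=> + uP b0; elim: N g => [|N IH] g pg; first by exists b, B.
have [b' [B' [uP' b'0 bb']]] := IH (g \o succn) (fun i => pg i.+1).
have I0 := potential_Rintegral_gt0 (pg 0%N).
exists (lo * (b' * \int[mu]_x g 0%N x))%R, (hi * (B' * \int[mu]_x g 0%N x))%R.
split; first exact: between_transfer.
  by rewrite !mulr_ge0// ltW// (lower_gt0 qD).
by move=> /bb' ?; rewrite !mulr_gt0// (lower_gt0 qD).
Qed.

(** Iterating the contraction: the interval [[a, a + r]] that contains the ratio
[u / v] is transported backward and shrinks by the same factor at each step,
whatever the weights are. *)
Lemma transfers_contraction g N bu Bu bv Bv u v a r :
  (forall i, potential (g i)) ->
  measurable_between bu Bu u -> (0 <= bu)%R ->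
  measurable_between bv Bv v -> (0 <= bv)%R ->
  (0 <= a)%R -> (0 <= r)%R ->
  (forall x, (a * v x <= u x <= (a + r) * v x)%R) ->
  exists2 a', (0 <= a')%R & forall x,
    (a' * transfers g N v x <= transfers g N u x
     <= (a' + (1 - lo / hi) ^+ N * r) * transfers g N v x)%R.
Proof.
move=> + uP bu0 vP bv0 a0 r0 uv; elim: N g => [|N IH] g pg.
  by exists a => // x; rewrite expr0 mul1r.
have pg' i : potential ((g \o succn) i) := pg i.+1.
have [a' a'0 IHa] := IH _ pg'.
have [b1 [B1 [uP1 b10 _]]] := between_transfers N pg' uP bu0.
have [b2 [B2 [vP2 b20 _]]] := between_transfers N pg' vP bv0.
have [igu _ _] := potential_mul_integralP (pg 0%N) uP1 b10.
have [igv _ _] := potential_mul_integralP (pg 0%N) vP2 b20.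
have lo0 := lower_gt0 qD; have lohi := lower_le_upper qD.
have rN0 : (0 <= (1 - lo / hi) ^+ N * r)%R.
  rewrite mulr_ge0// exprn_ge0// subr_ge0 ler_pdivrMr ?mul1r//.
  exact: lt_le_trans lohi.
have g0 := potential_ge0 (pg 0%N).
rewrite exprS -mulrA.
apply: (doeblin_contraction igv igu a'0 rN0) => x.
  by rewrite mulr_ge0// (le_trans b20)//; have /andP[] := vP2.2 x.
have /andP[h1 h2] := IHa x.
rewrite !(mulrCA _ (g 0%N x)); apply/andP; split; exact: ler_wpM2l.
Qed.

Lemma between_mul b B b' B' (u v : T -> R) : (0 <= b)%R -> (0 <= b')%R ->
  measurable_between b B u -> measurable_between b' B' v ->
  measurable_between (b * b')%R (B * B')%R (fun x => u x * v x)%R.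
Proof.
move=> b0 b'0 [mu_ uB] [mv vB]; split; first exact: measurable_funM.
move=> x; have /andP[bu uB'] := uB x; have /andP[bv vB'] := vB x.
have u0 := le_trans b0 bu; have v0 := le_trans b'0 bv.
by rewrite !ler_pM.
Qed.

Lemma transferZ g b B u c x :
  potential g -> measurable_between b B u -> (0 <= b)%R ->
  transfer g (fun x' => c * u x')%R x = (c * transfer g u x)%R.
Proof.
move=> pg uP b0; have [igu _ _] := potential_mul_integralP pg uP b0.
have gu0 x' : (0 <= g x' * u x')%R.
  by rewrite mulr_ge0 ?(potential_ge0 pg)// (le_trans b0)//; have /andP[] := uP.2 x'.
have [iq _ _] := density_integralP x gu0 igu.
by rewrite /transfer -RintegralZl//; apply: eq_Rintegral => x' _; ring.
Qed.

Lemma potential1 : potential (fun=> 1%R).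
Proof.
have I1 : \int[mu]_x (1%R)%:E = 1 :> \bar R.
  rewrite integral_cst// mul1e. exact: probability_setT.
by split => //; rewrite I1 ?lte01 ?ltry.
Qed.

Lemma transfers_add g j i u :
  transfers g (j + i) u = transfers g j (transfers (fun k => g (j + k)%N) i u).
Proof. by elim: j g => [//|j IH] g; rewrite addSn /= IH. Qed.

Lemma integral_between b B u : (0 <= b)%R -> measurable_between b B u ->
  exists2 I, (b <= I <= B)%R & \int[mu]_x (u x)%:E = I%:E.
Proof.
move=> b0 uP; have [iu lI Ih] := potential_mul_integralP potential1 uP b0.
have I1 : (\int[mu]_x (1 : R))%R = 1%R.
  rewrite Rintegral_cst// mul1r -[RHS]/(fine 1%:E); congr fine.
  exact: probability_setT.
move: iu lI Ih; rewrite I1 !mulr1; under [X in EFin \o X]eq_fun do rewrite mul1r.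
under eq_Rintegral do rewrite mul1r.
move=> iu lI Ih; exists (\int[mu]_x u x)%R; first by rewrite lI.
by rewrite /Rintegral fineK// (integrable_fin_num _ iu).
Qed.

Lemma between1 : measurable_between 1%R 1%R (fun=> 1%R).
Proof. by split => // x; rewrite lexx. Qed.

Lemma transfers1_gt0 g N x : (forall i, potential (g i)) ->
  (0 < transfers g N (fun=> 1%R) x)%R.
Proof.
move=> pg; have [b [B [[_ bB] _ /(_ ltr01) b0]]] :=
  between_transfers N pg between1 ler01.
by have /andP[+ _] := bB x; apply: lt_le_trans.
Qed.

End transfer_operator.

(** * Path integrals as iterated transfers *)

Section path_integrals.
Context (R : realType) (X : pseudoPMetricType R).
Variables (mu : probability (borel X) R) (q : borel X -> borel X -> R)
  (lo hi : R).

(** The likelihoods are an arbitrary sequence of functions of the state, so that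
dropping the first transition of the path amounts to shifting the sequence. *)
Definition weight (g : nat -> borel X -> R) N (x : borel X)
    (t : N.-tuple (borel X)) : R :=
  (\prod_(i < N) (q (path_state x t i) (path_state x t i.+1) *
     g i (path_state x t i.+1)))%R.

(** Out of range, the two sides return different default states. *)
Lemma path_state_cons N (x x' : borel X) (t : N.-tuple (borel X)) i :
  (i <= N)%N -> path_state x (tuple_cons (x', t)) i.+1 = path_state x' t i.
Proof.
move=> iN; rewrite /path_state /=.
by apply: (@set_nth_default _ (x' :: t) x' x); rewrite /= size_tuple ltnS.
Qed.

Lemma weight_cons g N (x x' : borel X) (t : N.-tuple (borel X)) :
  weight g x (tuple_cons (x', t)) =
  (q x x' * (g 0%N x' * weight (g \o succn) x' t))%R.
Proof.
rewrite /weight big_ord_recl mulrA; congr (_ * _)%R.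
apply: eq_bigr => i _; rewrite lift0 !path_state_cons//; exact: ltnW.
Qed.

Lemma measurable_path_state N i :
  measurable_fun [set: borel X * N.-tuple (borel X)]
    (fun z => path_state z.1 z.2 i).
Proof.
case: i => [|i]; first exact: measurable_fst.
have [iN|Ni] := ltnP i N.
  rewrite (_ : (fun z => _) = (fun t => tnth t (Ordinal iN)) \o snd).
    exact: measurableT_comp (measurable_tnth _) measurable_snd.
  by apply/funext => z /=; rewrite /path_state (tnth_nth z.1).
rewrite (_ : (fun z => _) = fst); first exact: measurable_fst.
by apply/funext => z; rewrite /path_state nth_default//= size_tuple.
Qed.

Lemma ge0_integral_power_measureS N (F : N.+1.-tuple (borel X) -> \bar R) :
  measurable_fun [set: N.+1.-tuple (borel X)] F -> (forall t, 0 <= F t) ->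
  \int[power_measure mu N.+1]_t F t =
  \int[mu]_x \int[power_measure mu N]_t F (tuple_cons (x, t)).
Proof.
move=> mF F0; rewrite /= ge0_integral_distribution//.
rewrite (@fubini_tonelli1 _ _ _ _ _ mu (power_measure mu N)
  (F \o (@tuple_cons _ _ N)))//.
  by apply: measurableT_comp => //; exact: measurable_tuple_cons.
by move=> z; exact: F0.
Qed.

Hypothesis qD : doeblin_density mu q lo hi.

Lemma weight_ge0 g N x (t : N.-tuple (borel X)) :
  (forall i, potential mu (g i)) -> (0 <= weight g x t)%R.
Proof.
move=> pg; apply: prodr_ge0 => i _.
by rewrite mulr_ge0 ?(density_ge0 qD)// (potential_ge0 (pg i)).
Qed.

Lemma measurable_weight g N : (forall i, potential mu (g i)) ->
  measurable_fun [set: borel X * N.-tuple (borel X)]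
    (fun z => weight g z.1 z.2).
Proof.
move=> pg; apply: measurable_prod => i _; apply: measurable_funM.
  apply: (measurableT_comp (density_measurable qD)
    (g := fun z => (path_state z.1 z.2 i, path_state z.1 z.2 i.+1))).
  by apply: measurable_fun_pair; exact: measurable_path_state.
exact: (measurableT_comp (potential_measurable (pg i))
  (@measurable_path_state N i.+1)).
Qed.

Lemma measurable_weight_path g N j x h : (forall i, potential mu (g i)) ->
  measurable_fun [set: borel X] h ->
  measurable_fun [set: N.-tuple (borel X)]
    (fun t => (weight g x t * h (path_state x t j))%:E).
Proof.
move=> pg mh; apply/measurable_EFinP.
apply: (measurableT_comp (f := fun z : borel X * N.-tuple (borel X) =>
  (weight g z.1 z.2 * h (path_state z.1 z.2 j))%R) _ (pair1_measurable x)).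
apply: measurable_funM; first exact: measurable_weight.
exact: (measurableT_comp mh (@measurable_path_state N j)).
Qed.

(** Tonelli's theorem peels off the states from the first one on.  At index [j]
the value [h] of the current state multiplies the likelihood of the remaining
observations, which is obtained by continuing with the constant 1. *)
Lemma integral_weight_path g N j (h : borel X -> R) B x :
  (forall i, potential mu (g i)) -> (j <= N)%N -> measurable_between 0%R B h ->
  \int[power_measure mu N]_t (weight g x t * h (path_state x t j))%:E =
  (transfers mu q g j (fun x' => h x' *
     transfers mu q (fun i => g (j + i)%N) (N - j) (fun=> 1) x')%R x)%:E.
Proof.
move=> pg jN hP.
elim: N j jN g x pg h B hP => [|N IH] j jN g x pg h B hP; have [mh hB] := hP.
  move: jN; rewrite leqn0 => /eqP -> /=.
  rewrite integral_dirac//; last exact: measurable_weight_path.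
  by rewrite diracT mul1e /weight big_ord0 mul1r mulr1.
have h0 z : (0 <= h z)%R by have /andP[] := hB z.
rewrite ge0_integral_power_measureS//; first last.
  by move=> t; rewrite lee_fin mulr_ge0// weight_ge0.
  exact: measurable_weight_path.
have pg' i : potential mu ((g \o succn) i) := pg i.+1.
(* Removing the first transition leaves a path of length N, observed at index i
   through f; both cases below have this form. *)
have step i f C : (i <= N)%N -> measurable_between 0%R C f ->
    \int[mu]_x' \int[power_measure mu N]_t
      (q x x' * (g 0%N x' *
        (weight (g \o succn) x' t * f (path_state x' t i))))%:E =
    (transfer mu q (g 0%N) (transfers mu q (g \o succn) i (fun x' => f x' *
       transfers mu q (fun k => g (i + k).+1) (N - i) (fun=> 1) x')%R) x)%:E.
  move=> iN fP; have [mf fC] := fP.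
  have pgi k : potential mu (g (i + k).+1) := pg (i + k).+1.
  have [b1 [B1 [P1 b10 _]]] := between_transfers qD (N - i) pgi (between1 _ _) ler01.
  have P1' := between_mul (lexx 0%R) b10 fP P1; rewrite mul0r in P1'.
  have [b2 [B2 [P2 b20 _]]] := between_transfers qD i pg' P1' (lexx 0%R).
  rewrite (transferE qD _ (pg 0%N) P2 b20); apply: eq_integral => x' _.
  under eq_integral do rewrite mulrA EFinM.
  rewrite ge0_integralZl//.
  - by rewrite (IH i iN _ x' pg' f C fP) -EFinM mulrA.
  - exact: measurable_weight_path.
  - move=> t _; rewrite lee_fin mulr_ge0 ?weight_ge0//.
    by have /andP[] := fC (path_state x' t i).
  - by rewrite lee_fin mulr_ge0 ?(density_ge0 qD)// (potential_ge0 (pg 0%N)).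
case: j jN => [|j] jN.
  (* For j = 0 the observed state is x itself, so f is the constant h x. *)
  have cP : measurable_between 0%R B (fun=> h x : R) (T := borel X) by [].
  have [b1 [B1 [P1 b10 _]]] := between_transfers qD N pg' (between1 _ _) ler01.
  transitivity (transfer mu q (g 0%N)
    (fun x' => h x * transfers mu q (g \o succn) N (fun=> 1) x')%R x)%:E.
    rewrite -[in RHS](subn0 N) -(step 0%N _ _ (leq0n N) cP).
    apply: eq_integral => x' _; apply: eq_integral => t _.
    by rewrite weight_cons /path_state /= -!mulrA.
  by rewrite (transferZ qD _ _ (pg 0%N) P1 b10).
rewrite -(step j h B)//; apply: eq_integral => x' _; apply: eq_integral => t _.
by rewrite weight_cons path_state_cons// -!mulrA.
Qed.

End path_integrals.

(** * The conditional law *)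

Section conditional_law.
Context (R : realType) (X : pseudoPMetricType R)
  (Y : completePseudoMetricType R) (s : nat).
Variables (mu : probability (borel X) R)
  (nu : {sigma_finite_measure set (borel Y) -> \bar R})
  (q : borel X -> borel X -> R)
  (g : borel Y -> s.-tuple (borel Y) -> borel X -> R) (lo hi : R).
Hypotheses (qgD : transition_densities mu nu q g)
  (qD : doeblin_density mu q lo hi)
  (gP : forall y' ybar, potential mu (g y' ybar)).

(** The likelihoods of the steps after time [n], which carry no observation. *)
Let cst1 : nat -> borel X -> R := fun _ _ => 1%R.

Let cst1P i : potential mu (cst1 i).
Proof. exact: potential1. Qed.

Let between01 : measurable_between 0%R 1%R (fun=> 1%R : R) (T := borel X).
Proof. by split => // z; rewrite ler01 lexx. Qed.

Lemma between_indic (A : set (borel X)) : measurable A ->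
  measurable_between (0 : R) 1 (\1_A : borel X -> R).
Proof.
move=> mA; split; first exact: measurable_indic.
by move=> x; rewrite indicE ler0n lern1 leq_b1.
Qed.

Lemma transfers1 l x : transfers mu q cst1 l (fun=> 1%R) x = 1%R.
Proof.
elim: l x => [//|l IH] x /=.
rewrite /transfer; under eq_Rintegral do rewrite IH !mulr1.
by rewrite /Rintegral (q_integral qgD).
Qed.

Lemma Q_iterE l x A : measurable A ->
  Q_iter mu q l x A = (transfers mu q cst1 l \1_A x)%:E.
Proof.
move=> mA; elim: l x => [//|l IH] x /=.
have [b [B [P b0 _]]] := between_transfers qD l cst1P (between_indic mA) (lexx 0%R).
rewrite (transferE qD _ (cst1P 0) P b0).
by apply: eq_integral => x' _; rewrite IH mul1r EFinM.
Qed.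

(** The indices are those of [path_weight], so that [path_weight q g y m] is
[weight q (likelihoods y m)] by conversion. *)
Definition likelihoods (y : int -> borel Y) (m : int) (i : nat) : borel X -> R :=
  g (y (m + i.+1%:Z)%R) (lags s y (m + i%:Z)%R).

Lemma path_expectationE y m N j h B x : (j <= N)%N -> measurable_between 0%R B h ->
  path_expectation mu q g y m x
    (fun t : N.-tuple (borel X) => (h (path_state x t j))%:E) =
  (transfers mu q (likelihoods y m) j (fun x' => h x' *
     transfers mu q (fun i => likelihoods y m (j + i)%N) (N - j) (fun=> 1) x') x /
   transfers mu q (likelihoods y m) N (fun=> 1) x)%R%:E.
Proof.
move=> jN hP; have gP' i : potential mu (likelihoods y m i) by exact: gP.
have := integral_weight_path qD x gP' (leq0n N) between01.
rewrite subn0 /= mul1r => den.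
rewrite /path_expectation EFinM -(integral_weight_path qD x gP' jN hP).
congr (_ * _^-1%:E).
rewrite -[RHS]/(fine _%:E) -den; congr fine.
by apply: eq_integral => t _; rewrite mulr1.
Qed.

(** [j] is the number of transitions between [m] and [min k n], weighted by
observations, and [l] the number of free transitions between [n] and [k]. *)
Lemma cond_lawE y m n k : (m <= n)%R -> (m <= k)%R ->
  exists j l, [/\ (j <= `|n - m|)%N, (j + l = `|k - m|)%N &
    forall x A, measurable A -> cond_law mu q g y m n k x A =
    (transfers mu q (likelihoods y m) j
       (fun x' => transfers mu q cst1 l \1_A x' *
          transfers mu q (fun i => likelihoods y m (j + i)%N) (`|n - m| - j)
            (fun=> 1) x') x /
     transfers mu q (likelihoods y m) `|n - m| (fun=> 1) x)%R%:E].
Proof.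
move=> mn mk; rewrite /cond_law; have [->|kNm] := eqVneq k m.
  exists 0%N, 0%N; split => //; first by rewrite subrr.
  (* The likelihood of all observations cancels against itself. *)
  move=> x A mA; rewrite /= subn0 mulfK//.
  by apply: lt0r_neq0; apply: (transfers1_gt0 qD) => i; exact: gP.
have [kn|nk] := leP k n.
  exists `|k - m|%N, 0%N; split; [lia|lia|] => x A mA.
  rewrite (path_expectationE _ _ _ _ (between_indic mA))//; lia.
exists `|n - m|%N, `|k - n|%N; split; [lia|lia|] => x A mA.
have [b [B [hP b0 _]]] :=
  between_transfers qD `|k - n|%N cst1P (between_indic mA) (lexx 0%R).
have hP0 : measurable_between 0%R B (transfers mu q cst1 `|k - n|%N \1_A).
  split; first exact: hP.1.
  by move=> z; have /andP[bz ->] := hP.2 z; rewrite (le_trans b0).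
rewrite -(path_expectationE _ _ _ _ hP0)//; congr path_expectation.
by apply/funext => t; rewrite Q_iterE.
Qed.

(** The [l] free steps are compared with the constant 1, which they preserve;
this confines the numerator at time [m + j] to an interval of length
[(1 - lo / hi) ^+ l] relative to the likelihood [v] of the later observations.
The [j] weighted steps then contract further, and carry [v] to the normalising
constant. *)
Lemma cond_law_oscillation y m n k A : (m <= n)%R -> (m <= k)%R -> measurable A ->
  exists a f, [/\ (0 <= a)%R,
    measurable_between a (a + (1 - lo / hi) ^+ `|k - m|)%R f &
    forall x, cond_law mu q g y m n k x A = (f x)%:E].
Proof.
move=> mn mk mA; have [j [l [jN <- E]]] := cond_lawE y mn mk.
set r := (1 - lo / hi)%R.
have r0 i : (0 <= r ^+ i)%R.
  apply: exprn_ge0; rewrite subr_ge0 ler_pdivrMr ?mul1r ?(lower_le_upper qD)//.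
  exact: lt_le_trans (lower_gt0 qD) (lower_le_upper qD).
have gP' i : potential mu (likelihoods y m i) by exact: gP.
have oneP := @between1 _ (borel X) R.
have indP := between_indic mA.
have [b1 [B1 [hP b10 _]]] := between_transfers qD l cst1P indP (lexx 0%R).
have [b2 [B2 [vP b20 _]]] := between_transfers qD (`|n - m| - j)%N
  (fun i => gP' (j + i)%N) oneP ler01.
have := transfers_contraction qD l cst1P indP (lexx 0%R) oneP ler01 (lexx 0%R) ler01.
have ind01 x : (0 * 1 <= (\1_A x : R) <= (0 + 1) * 1)%R.
  by rewrite mul0r add0r mul1r; exact: indP.2.
move=> /(_ ind01)[a1 a10 ha1].
have uP := between_mul b10 b20 hP vP.
have uv x : (a1 * transfers mu q (fun i => likelihoods y m (j + i)%N)
              (`|n - m| - j) (fun=> 1) x <= transfers mu q cst1 l \1_A x *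
              transfers mu q (fun i => likelihoods y m (j + i)%N)
              (`|n - m| - j) (fun=> 1) x <= (a1 + r ^+ l) * 
              transfers mu q (fun i => likelihoods y m (j + i)%N)
              (`|n - m| - j) (fun=> 1) x)%R.
  have /andP[vge _] := vP.2 x; have v0 := le_trans b20 vge.
  have := ha1 x; rewrite transfers1 !mulr1 => /andP[h1 h2].
  by rewrite !ler_wpM2r.
have [a a0 ha] := transfers_contraction qD j gP' uP (mulr_ge0 b10 b20) vP b20
  a10 (r0 l) uv.
have [b3 [B3 [[mnum _] _ _]]] := between_transfers qD j gP' uP (mulr_ge0 b10 b20).
have [b4 [B4 [[mden denP] _ /(_ ltr01) b4_gt0]]] :=
  between_transfers qD `|n - m|%N gP' oneP ler01.
set num := transfers _ _ _ j _ in mnum ha E.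
set den := transfers _ _ _ `|n - m| _ in mden denP E.
have den0 x : (0 < den x)%R.
  by have /andP[+ _] := denP x; apply: lt_le_trans.
exists a, (fun x => num x / den x)%R; split=> //; last by move=> x; rewrite E.
split.
  (* Inversion of positive reals is measurable as a real power. *)
  rewrite (_ : (fun x => _) = fun x => num x * (den x) `^ (-1))%R.
    apply: measurable_funM => //.
    exact: measurableT_comp (measurable_powR _) mden.
  by apply/funext => x; rewrite powR_inv1// ltW.
move=> x; rewrite ler_pdivlMr// ler_pdivrMr// exprD.
by have := ha x; rewrite -transfers_add subnKC.
Qed.

End conditional_law.

(** * Consequences of the boundedness assumptions *)

Section assumption_A1_consequences.
Context (R : realType) (X : pseudoPMetricType R)
  (Y : completePseudoMetricType R) (s : nat) (T : Type).
Variables (mu : probability (borel X) R)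
  (nu : {sigma_finite_measure set (borel Y) -> \bar R}) (Theta : set T)
  (q : T -> borel X -> borel X -> R)
  (g : T -> borel Y -> s.-tuple (borel Y) -> borel X -> R).
Hypotheses (hA1 : A1 mu Theta q g)
  (hqg : forall theta, Theta theta ->
    transition_densities mu nu (q theta) (g theta)).
Variable theta : T.
Hypothesis htheta : Theta theta.

(** The bounds are finite because [q(x, .)] has integral 1 against a probability
measure, so that [sigma_minus <= 1 <= sigma_plus]. *)
Lemma A1_doeblin : doeblin_density mu (q theta)
  (fine (sigma_minus mu Theta q)) (fine (sigma_plus mu Theta q)).
Proof.
have qgD := hqg htheta; have [sm0 spoo _ _] := hA1.
set sm := sigma_minus _ _ _ in sm0 *; set sp := sigma_plus _ _ _ in spoo *.
have smq x : \forall x' \ae mu, sm <= (q theta x x')%:E.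
  apply/ess_infP/ereal_inf_lbound.
  by exists theta => //; exists x.
have qsp x : \forall x' \ae mu, (q theta x x')%:E <= sp.
  apply/ess_supP/ereal_sup_ubound.
  by exists theta => //; exists x.
have mq x : measurable_fun [set: borel X] (EFin \o q theta x).
  apply/measurable_EFinP.
  exact: (measurableT_comp (q_measurable qgD) (pair1_measurable x)).
have cst1 c : \int[mu]__ c = c :> \bar R.
  rewrite integral_cst// -[RHS]mule1; congr (_ * _).
  exact: probability_setT.
have q0 := q_ge0 qgD; pose x0 : borel X := point.
have sp0 : 0 <= sp.
  apply: (@le_trans _ _ (ess_sup mu (EFin \o q theta x0)));
    last by apply/ess_supP; exact: qsp.
  apply: ess_sup_gee; last by apply: nearW => x' /=; rewrite lee_fin.
  by have := @lte01 R; rewrite -[X in _ < X](probability_setT mu).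
have sm1 : sm <= 1.
  rewrite -(cst1 sm) -(q_integral qgD x0); apply: ae_ge0_le_integral => //.
  - by move=> ? _; exact: ltW.
  - by move=> ? _; rewrite lee_fin.
  - exact: mq.
  - by apply: filterS (smq x0) => x' + _.
have sp1 : 1 <= sp.
  rewrite -(cst1 sp) -(q_integral qgD x0); apply: ae_ge0_le_integral => //.
  - by move=> ? _; rewrite lee_fin.
  - exact: mq.
  - by apply: filterS (qsp x0) => x' + _.
have smE : (fine sm)%:E = sm.
  by rewrite fineK// fin_real// (lt_trans _ sm0)//= (le_lt_trans sm1)// ltry.
have spE : (fine sp)%:E = sp.
  by rewrite fineK// fin_real// spoo (lt_le_trans _ sp1)// ltNyr.
split => //.
- exact: q_measurable qgD.
- by rewrite -lte_fin smE.
- by rewrite -lee_fin smE spE (le_trans sm1).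
- by move=> x; apply: filterS (smq x) => x'; rewrite -smE lee_fin.
- by move=> x; apply: filterS (qsp x) => x'; rewrite -spE lee_fin.
Qed.

Lemma A1_potential y' ybar : potential mu (g theta y' ybar).
Proof.
have qgD := hqg htheta; split.
- pose c (x : borel X) := (y', (ybar, x)).
  apply: (measurableT_comp (g_measurable qgD) (g := c)).
  exact: measurableT_comp (pair1_measurable y') (pair1_measurable ybar).
- exact: g_ge0 qgD y' ybar.
- apply: lt_le_trans (A1b_inf hA1 y' ybar) _; apply: ereal_inf_lbound.
  by exists theta.
- apply: le_lt_trans (A1b_sup hA1 y' ybar); apply: ereal_sup_ubound.
  by exists theta.
Qed.

End assumption_A1_consequences.

(** * The bound in total variation *)

Theorem corollary1 (R : realType) (X : pseudoPMetricType R)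
    (Y : completePseudoMetricType R) (s d : nat)
    (mu : probability (borel X) R)
    (nu : {sigma_finite_measure set (borel Y) -> \bar R})
    (Theta : set 'rV[R]_d)
    (q : 'rV[R]_d -> borel X -> borel X -> R)
    (g : 'rV[R]_d -> borel Y -> s.-tuple (borel Y) -> borel X -> R)
    (hX : compact_metrizable X)
    (hY : separable_complete_metrizable Y)
    (hs : (1 <= s)%N)
    (hTheta : compact Theta)
    (hqg : forall theta, Theta theta ->
       transition_densities mu nu (q theta) (g theta))
    (hinv : forall theta, Theta theta ->
       unique_invariant_distribution mu nu (q theta) (g theta))
    (hA1 : A1 mu Theta q g)
    (m n : int) (hmn : (m <= n)%R)
    (theta : 'rV[R]_d) (htheta : Theta theta)
    (k : int) (hk : (m <= k)%R)
    (mu1 mu2 : probability (borel X) R)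
    (y : int -> borel Y) :
  tv_dist
    (fun A => \int[mu1]_x cond_law mu (q theta) (g theta) y m n k x A)
    (fun A => \int[mu2]_x cond_law mu (q theta) (g theta) y m n k x A)
  <= ((rho mu Theta q) ^ (k - m))%R%:E.
Proof.
have qD := A1_doeblin hA1 hqg htheta.
have gP := A1_potential hA1 hqg htheta.
apply: ge_ereal_sup => _ [A mA <-].
have [a [f [a0 fP E]]] := cond_law_oscillation (hqg _ htheta) qD gP y hmn hk mA.
have [I1 I1P EI1] := integral_between mu1 a0 fP.
have [I2 I2P EI2] := integral_between mu2 a0 fP.
rewrite (eq_integral _ _ (fun x _ => E x)) EI1.
rewrite (eq_integral _ _ (fun x _ => E x)) EI2.
rewrite -EFinB abse_EFin lee_fin /rho.
have -> : (k - m)%R = `|k - m|%N by lia.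
rewrite -exprnP ler_norml; apply/andP; split; lra.
Qed.
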